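(* Let $\mathcal T$ be a subsequential, complete, finally connected and finally aperiodic transducer with an arbitrary finite input alphabet $\mathcal A_I$. The following assertions are equivalent: (a) The asymptotic variance $v_2$ of the output sum is $0$. (b) There exist a state $s$ of the final component and a constant $k\in\mathbb R$ such that $\delta(C)=k\,\mathds{1}(C)$ holds for every closed walk $C$ of the final component visiting the state $s$ exactly once. (c) There exists a constant $k\in\mathbb R$ such that $\delta(C)=k\,\mathds{1}(C)$ holds for every directed cycle $C$ of the final component of $\mathcal T$. In that case, $kn+\mathcal O(1)$ is the expected value of the output sum $\mathsf{Output}(X_n)$, and the statement in (b) holds for all states $s$ of the final component.
   Context: A transducer consists of a finite set of states $\{1,\dots,S\}$, a finite input alphabet $\mathcal A_I\subseteq\mathbb R$, an output alphabet $\mathcal A_O\subseteq\mathbb R$, a set of transitions $\mathcal E\subseteq\{1,\dots,S\}^2\times\mathcal A_I$, output labels $\delta\colon\mathcal E\to\mathcal A_O$, and the initial state $1$. A transition $e=(s,t,\varepsilon)$ goes from $s$ to $t$ and has input label $\varepsilon(e)=\varepsilon$ and output label $\delta(e)$. The underlying graph is the directed multigraph (loops and parallel edges allowed) whose vertices are the states and whose edges are the transitions. The transducer is deterministic if for every state $s$ and $\varepsilon\in\mathcal A_I$ there is at most one $t$ with $(s,t,\varepsilon)\in\mathcal E$; complete if for every $s$ and $\varepsilon\in\mathcal A_I$ there is some $t$ with $(s,t,\varepsilon)\in\mathcal E$; subsequential if it is deterministic, every state is final, and it has a final output $a\colon\{1,\dots,S\}\to\mathcal A_O$. It is finally connected if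 some state can be reached from every other state; its final component is then the transducer induced by the set of all states which can be reached from every other state. A finally connected transducer is finally aperiodic if the underlying graph of the final component is aperiodic (the gcd of the lengths of all closed walks starting and ending at a given vertex is $1$). Throughout, $\mathcal A_I$ has at least two elements. Let $X_n$ be uniformly distributed on $\mathcal A_I^n$. The output of the transducer on an input word is the sequence of output labels along the unique path starting at state $1$ whose input labels are the word (read in a fixed direction, from right to left), together with the final output label of the last state of this path. $\mathsf{Output}(X_n)$ is the sum of the output sequence. There is a constant $v_2$ with $\mathbb V(\mathsf{Output}(X_n))=v_2n+\mathcal O(1)$; it is called the asymptotic variance of the output sum. A cycle is a strongly connected digraph in which every vertex has out-degree $1$ (a loop is a cycle of length $1$). A closed walk is an alternating sequence of vertices and edges $(s_1,e_1,s_2,\dots,e_n,s_{n+1}=s_1)$ such that $e_j$ is an edge from $s_j$ to $s_{j+1}$; it visits $s$ exactly once if exactly one of $s_1,\dots,s_n$ equals $s$. For a function $g$ on transitions and a walk $C$, $g(C)=\sum_{e\in C}g(e)$, counted with multiplicities; $\mathds{1}$ is the constant function $1$, so $\mathds 1(C)$ is the length of $C$. *)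

(* Defs.v *)
From HB Require Import structures.
From mathcomp Require Import all_boot all_order all_algebra finmap.
From mathcomp Require Import boolp classical_sets reals topology normedtype landau sequences.

Set Implicit Arguments.
Unset Strict Implicit.
Unset Printing Implicit Defensive.

Import Order.TTheory GRing.Theory Num.Theory.
Import numFieldNormedType.Exports.

Local Open Scope ring_scope.

(* The S = predS.+1 states are the elements of 'I_S, and the initial state
   is ord0.  The letters form a finite set of real numbers, which coerces to a
   finType; a transition (s, t, x) goes from s to t and has input label x. *)
Record transducer (R : realType) := Transducer {
  predS : nat;
  input_alphabet : {fset R};
  output_alphabet : set R;
  transitions : {set 'I_predS.+1 * 'I_predS.+1 * input_alphabet};
  delta : {e | e \in transitions} -> output_alphabet
}.

Section Transducer.
Variables (R : realType) (T : transducer R).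

Definition state : finType := 'I_(predS T).+1.
Definition letter : finType := input_alphabet T.
Definition edge : finType := {e | e \in transitions T}.

Definition initial : state := ord0.
Definition source (e : edge) : state := (val e).1.1.
Definition target (e : edge) : state := (val e).1.2.
Definition label (e : edge) : letter := (val e).2.
Definition out (e : edge) : R := val (delta e).

Definition deterministic : Prop :=
  forall (s t t' : state) (x : letter),
    (s, t, x) \in transitions T -> (s, t', x) \in transitions T -> t = t'.

Definition complete : Prop :=
  forall (s : state) (x : letter), exists t, (s, t, x) \in transitions T.

Definition step : rel state :=
  fun s t => [exists e : edge, (source e == s) && (target e == t)].

Definition reachable_from_all (s : state) : bool := [forall t, connect step t s].

Definition finally_connected : Prop := exists s, reachable_from_all s.

(* The final component is the induced sub-transducer: its edges are all the
   transitions having both ends in the set of states below. *)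
Definition final_states : {set state} := [set s | reachable_from_all s].
Definition final_edges : {set edge} :=
  [set e | (source e \in final_states) && (target e \in final_states)].

(* A closed walk is given by its sequence of edges (path.cycle also requires
   the last edge to lead back to the source of the first one). *)
Definition closed_walk (w : seq edge) : bool :=
  cycle (fun e f => target e == source f) w.

Definition final_closed_walk (w : seq edge) : bool :=
  closed_walk w && all [in final_edges] w.

(* The empty walk is a closed walk at every vertex. *)
Definition starts_at (s : state) (w : seq edge) : bool :=
  head s [seq source e | e <- w] == s.

Definition visits_exactly_once (w : seq edge) (s : state) : bool :=
  count (fun e => source e == s) w == 1%N.

(* g is the gcd of L when the common divisors of L are the divisors of g. *)
Definition is_gcd (L : set nat) (g : nat) : Prop :=
  forall d : nat, (forall l, L l -> (d %| l)%N) <-> (d %| g)%N.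

Definition finally_aperiodic : Prop :=
  forall s, s \in final_states ->
    is_gcd [set l | exists w, [/\ final_closed_walk w, starts_at s w
                                & size w = l]]%classic 1.

(* The directed cycles are subgraphs, with vertex set V and edge set C. *)
Definition subgraph (V : {set state}) (C : {set edge}) : Prop :=
  forall e, e \in C -> (source e \in V) && (target e \in V).

Definition strongly_connected (V : {set state}) (C : {set edge}) : Prop :=
  {in V &, forall s t, connect
    (fun u v => [exists e in C, (source e == u) && (target e == v)]) s t}.

Definition directed_cycle (V : {set state}) (C : {set edge}) : Prop :=
  [/\ V != finset.set0, subgraph V C, strongly_connected V C
    & forall s, s \in V -> #|[set e in C | source e == s]| = 1%N].

Definition final_directed_cycle (V : {set state}) (C : {set edge}) : Prop :=
  [/\ V \subset final_states, C \subset final_edges & directed_cycle V C].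

(* delta(C) = k 1(C) for all closed walks C visiting s exactly once. *)
Definition closed_walks_through (s : state) (k : R) : Prop :=
  forall w, final_closed_walk w -> visits_exactly_once w s ->
    \sum_(e <- w) out e = k * (size w)%:R.

(* delta(C) = k 1(C) for all directed cycles C. *)
Definition all_directed_cycles (k : R) : Prop :=
  forall V C, final_directed_cycle V C ->
    \sum_(e in C) out e = k * #|C|%:R.

(* The run of a complete deterministic transducer from s, consuming the letters
   from left to right; without completeness it may stop early. *)
Fixpoint run (s : state) (u : seq letter) : seq edge :=
  if u is x :: u' then
    if [pick e : edge | (source e == s) && (label e == x)] is Some e
    then e :: run (target e) u'
    else [::]
  else [::].

End Transducer.

(* All states being final, the final output is defined on all states. *)
Record subsequential (R : realType) := Subsequential {
  subseq_transducer :> transducer R;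
  subseq_deterministic : deterministic subseq_transducer;
  final_output : state subseq_transducer -> output_alphabet subseq_transducer
}.

Local Open Scope classical_set_scope.

Section Output.
Variables (R : realType) (T : subsequential R).

Definition output_sequence (u : seq (letter T)) : seq R :=
  let p := run (initial T) (rev u) in
  rcons [seq out e | e <- p]
        (val (final_output (last (initial T) [seq target e | e <- p]))).

Definition output (u : seq (letter T)) : R := \sum_(y <- output_sequence u) y.

(* Expectation and variance for the uniform distribution on words of length n. *)
Definition expect (n : nat) (f : n.-tuple (letter T) -> R) : R :=
  (\sum_u f u) / #|{: n.-tuple (letter T)}|%:R.

Definition variance (n : nat) (f : n.-tuple (letter T) -> R) : R :=
  expect (fun u => (f u - expect f) ^+ 2).

Definition is_asymptotic_mean (k : R) : Prop :=
  (fun n : nat =>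
     expect (fun u : n.-tuple (letter T) => output u) - k * n%:R : R^o)
    =O_\oo (fun=> 1 : R^o).

(* At most one v satisfies this. *)
Definition is_asymptotic_variance (v : R) : Prop :=
  (fun n : nat =>
     variance (fun u : n.-tuple (letter T) => output u) - v * n%:R : R^o)
    =O_\oo (fun=> 1 : R^o).

End Output.

(* Main.v *)
(** Write the output as a Markov reward process.  A solution [(k, h)] of the
    Poisson equation [h + k = P h + E delta] turns [Output - k n] into a
    martingale plus a bounded term; the increments of the martingale are
    [delta(e) - k + h(target e) - h(source e)].  Its second moment is [v n + O(1)],
    where [v] is the stationary mean of the conditional variance of the increments
    (again by a Poisson equation), so the asymptotic variance vanishes iff all
    increments vanish on the final component, i.e. iff
    [delta(e) = k + h(source e) - h(target e)] there.  Such a potential exists iff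
    [delta - k] sums to zero on the closed walks through one fixed state, and every
    closed walk decomposes into directed cycles. *)

From HB Require Import structures.
Require Import Defs.
From mathcomp Require Import boolp reals topology normedtype landau.
From mathcomp Require Import all_boot all_order all_algebra finmap ring lra zify.

Set Implicit Arguments.
Unset Strict Implicit.
Unset Printing Implicit Defensive.

Import Order.TTheory GRing.Theory Num.Theory.
Import numFieldNormedType.Exports.

Local Open Scope ring_scope.

(** * Averages over finite types *)

Section Mean.
Variables (R : realFieldType) (I : finType).

Definition mean (f : I -> R) : R := (\sum_i f i) / #|I|%:R.

Lemma eq_mean f g : f =1 g -> mean f = mean g.
Proof. by move=> fg; rewrite /mean (eq_bigr g). Qed.

Lemma meanD f g : mean (fun i => f i + g i) = mean f + mean g.
Proof. by rewrite /mean big_split mulrDl. Qed.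

Lemma meanZ a f : mean (fun i => a * f i) = a * mean f.
Proof. by rewrite /mean -mulr_sumr mulrA. Qed.

Lemma meanN f : mean (fun i => - f i) = - mean f.
Proof. by rewrite /mean sumrN mulNr. Qed.

Lemma meanB f g : mean (fun i => f i - g i) = mean f - mean g.
Proof. by rewrite meanD meanN. Qed.

Lemma le_mean f g : (forall i, f i <= g i) -> mean f <= mean g.
Proof.
by move=> fg; rewrite ler_wpM2r ?invr_ge0 ?ler0n //; apply: ler_sum => i _.
Qed.

Lemma mean_ge0 f : (forall i, 0 <= f i) -> 0 <= mean f.
Proof. by move=> f0; rewrite divr_ge0 ?ler0n ?sumr_ge0. Qed.

Hypothesis I_gt0 : (0 < #|I|)%N.

Lemma mean_cst a : mean (fun=> a) = a.
Proof. by rewrite /mean sumr_const -[a *+ _]mulr_natr mulfK // pnatr_eq0 -lt0n. Qed.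

(** The deviations [m - f j] are nonnegative while their mean is at most zero, so each one
    vanishes. *)
Lemma mean_le_max f m i : (forall j, f j <= m) -> m <= mean f -> f i = m.
Proof.
move=> fm mf.
have s0 : \sum_j (m - f j) = 0.
  apply: le_anti; rewrite sumr_ge0 => [|j _]; last by rewrite subr_ge0.
  have: mean (fun j => m - f j) <= 0 by rewrite meanB mean_cst subr_le0.
  by rewrite /mean pmulr_lle0 ?invr_gt0 ?ltr0n // => ->.
apply/esym/eqP; rewrite -subr_eq0; apply/eqP.
by apply: (psumr_eq0P _ s0) => // j _; rewrite subr_ge0.
Qed.

Lemma mean_sqr_eq0 f : mean (fun i => f i ^+ 2) <= 0 -> forall i, f i = 0.
Proof.
move=> le0 i.
suff /eqP : - f i ^+ 2 = 0 by rewrite oppr_eq0 sqrf_eq0 => /eqP.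
apply: (mean_le_max (f := fun j => - f j ^+ 2)) => [j|]; first by rewrite oppr_le0 sqr_ge0.
by rewrite meanN oppr_ge0.
Qed.

End Mean.

(** * Averages over words, one letter at a time *)

Lemma mean_tuple0 (R : realFieldType) (A : finType) (F : seq A -> R) :
  mean (fun u : 0.-tuple A => F u) = F [::].
Proof.
rewrite (@eq_mean _ _ _ (fun=> F [::])) => [|u]; last by rewrite tuple0.
by rewrite mean_cst // card_tuple.
Qed.

Lemma mean_tupleS (R : realFieldType) (A : finType) n (F : seq A -> R) :
  mean (fun u : n.+1.-tuple A => F u) =
  mean (fun x => mean (fun u : n.-tuple A => F (x :: u))).
Proof.
rewrite /mean -mulr_suml -mulrA -invfM -natrM mulnC !card_tuple -expnS.
congr (_ / _); rewrite pair_big /=.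
rewrite (reindex (fun p : A * n.-tuple A => [tuple of p.1 :: p.2])) //=.
exists (fun u => (thead u, [tuple of behead u])) => [[x u] _|u _] /=.
  by congr (_, _); apply: val_inj.
by rewrite -tuple_eta.
Qed.

(** Reversal permutes the words of length [n]. This reconciles right-to-left reading with recursions
    on the first letter. *)
Lemma mean_rev (R : realFieldType) (A : finType) n (F : seq A -> R) :
  mean (fun u : n.-tuple A => F (rev u)) = mean (fun u : n.-tuple A => F u).
Proof.
rewrite /mean [in RHS](reindex_inj (h := fun u : n.-tuple A => [tuple of rev u])) //.
move=> u v /(congr1 val) /= uv; apply: val_inj => /=.
by rewrite -[LHS]revK uv revK.
Qed.

(** * Maximum principle and Poisson equation for finite Markov chains *)

Section Chain.
Variables (R : realFieldType) (S A : finType) (nx : S -> A -> S).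
Hypothesis A_gt0 : (0 < #|A|)%N.

Definition avg (h : S -> R) s := mean (fun x => h (nx s x)).

Definition reach (s t : S) := connect (fun s t => [exists x, nx s x == t]) s t.

(** At a maximiser of [h] over the closed set [F], unless it is [z], the average over the successors
    attains the maximum, hence so does every successor. Following a path to [z] carries the maximum
    there. *)
Lemma maximum_principle (F : {pred S}) (z : S) (h : S -> R) :
    (forall s x, s \in F -> nx s x \in F) ->
    (forall s, s \in F -> reach s z) ->
    (forall s, s \in F -> s != z -> h s <= avg h s) ->
  forall s, s \in F -> h s <= h z.
Proof.
move=> Fnx Fz hsub s sF.
pose t := [arg max_(t > s in F) h t]%O.
have [tF tmax] : t \in F /\ forall u, u \in F -> h u <= h t.
  by rewrite /t; case: arg_maxP.
suff -> : h z = h t by apply: tmax.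
have /connectP[p] := Fz _ tF.
move: {s sF} t tF tmax => t.
elim: p t => [|u p IH] t tF tmax /=; first by move=> _ ->.
have [-> //|tz] := eqVneq t z.
case/andP=> /existsP[x /eqP <-] pth zl.
have hx : h (nx t x) = h t.
  apply: (mean_le_max A_gt0 (f := fun x => h (nx t x))) => [y|]; last exact: hsub.
  by apply: tmax; apply: Fnx.
rewrite -hx; apply: (IH _ (Fnx _ _ tF)) => // w wF.
by rewrite hx tmax.
Qed.

(** The operator that is the identity at [z] and [h - avg h] elsewhere is linear on a
    finite-dimensional space. The maximum principle for [v] and [- v] makes its kernel trivial, so
    it is invertible. *)
Lemma dirichlet_solvable (z : S) : (forall s, reach s z) ->
  forall f : S -> R, exists h : S -> R,
    h z = 0 /\ forall s, s != z -> h s = avg h s + f s.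
Proof.
move=> zreach f.
pose L0 (h : {ffun S -> R^o}) : {ffun S -> R^o} :=
  [ffun s => if s == z then h s else h s - avg h s].
have L0lin : linear L0.
  move=> a u v; apply/ffunP=> s; rewrite !ffunE.
  have -> : avg (a *: u + v) s = a * avg u s + avg v s.
    rewrite /avg -meanZ -meanD; apply: eq_mean => x.
    by rewrite !ffunE.
  case: ifP => _ //.
  change (a * u s + v s - (a * avg u s + avg v s) = a * (u s - avg u s) + (v s - avg v s)).
  ring.
pose Lm := GRing.isLinear.Build _ _ _ _ L0 L0lin.
pose L : {linear {ffun S -> R^o} -> {ffun S -> R^o}} := HB.pack L0 Lm.
have kerL : lker (linfun L) == 0%VS.
  apply/eqP/vspaceP => v; rewrite memv0 memv_ker lfunE /=.
  apply/eqP/eqP => [Lv0|->]; last exact: (linear0 L).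
  have vE s : v s = if s == z then 0 else avg v s.
    have := congr1 (fun w : {ffun S -> R^o} => w s) Lv0; rewrite /= !ffunE; case: ifP => // _ /eqP.
    by rewrite subr_eq0 => /eqP.
  have vz : v z = 0 by rewrite vE eqxx.
  apply/ffunP => s; rewrite ffunE; apply: le_anti; apply/andP; split.
    rewrite -vz; apply: (@maximum_principle predT) => // t _ /negbTE tz.
    by rewrite vE tz.
  rewrite -oppr_le0 -oppr0 -vz.
  apply: (@maximum_principle predT z (fun s => - v s)) => // t _ /negbTE tz.
  by rewrite /avg meanN lerN2 vE tz.
pose g : {ffun S -> R^o} := [ffun s => if s == z then 0 else f s].
exists ((linfun L)^-1%VF g) => /=.
have Lg : L0 ((linfun L)^-1%VF g) = g.
  by rewrite -[LHS]/(L _) -(lfunE L) lker0_lfunVK.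
split=> [|s sz]; move: Lg => /ffunP; [move/(_ z) | move/(_ s)]; rewrite !ffunE.
  by rewrite eqxx.
by rewrite (negbTE sz) => <-; rewrite addrC subrK.
Qed.

(** Renewal argument: [ht] is the expected hitting time of [z], and [hf] the expected reward
    collected before hitting it. Every [hf - k * ht] solves the equation off [z]. *)
Lemma poisson_solvable (z : S) : (forall s, reach s z) ->
  forall f : S -> R, exists k h, forall s, h s + k = avg h s + f s.
Proof.
move=> zreach f.
have [hf [hfz hfE]] := dirichlet_solvable zreach f.
have [ht [htz htE]] := dirichlet_solvable zreach (fun=> 1).
have ht_ge0 s : 0 <= ht s.
  rewrite -oppr_le0 -oppr0 -htz.
  apply: (@maximum_principle predT z (fun s => - ht s)) => // t _ tz.
  by rewrite /avg meanN lerN2 htE // lerDl.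
have c_gt0 : 0 < avg ht z + 1.
  by rewrite ltr_wpDl // mean_ge0.
(* Forced by the equation at [z]: the expected reward of an excursion from [z] over its expected
   length. *)
pose k := (avg hf z + f z) / (avg ht z + 1).
exists k, (fun s => hf s - k * ht s) => s.
rewrite /avg meanB meanZ -/(avg hf s) -/(avg ht s).
have [->|sz] := eqVneq s z; last by rewrite hfE // htE //; ring.
rewrite hfz htz; have : k * (avg ht z + 1) = avg hf z + f z.
  by rewrite divfK // gt_eqF.
lra.
Qed.

(* The maximum principle for [u] and [- u] first kills the drift [c]. *)
Lemma poisson_unique (F : {pred S}) (u : S -> R) c z :
    (forall s x, s \in F -> nx s x \in F) ->
    (forall s t, s \in F -> t \in F -> reach s t) -> z \in F ->
    (forall s, s \in F -> u s = avg u s + c) ->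
  c = 0 /\ forall s, s \in F -> u s = u z.
Proof.
move=> Fnx Fconn zF.
have drift_ge0 v d : (forall s, s \in F -> v s = avg v s + d) -> 0 <= d.
  (* At a maximiser [t] over the closed class, [avg v t <= v t], which leaves a nonnegative
     drift. *)
  move=> vE; pose t := [arg max_(t > z in F) v t]%O.
  have [tF tmax] : t \in F /\ forall s, s \in F -> v s <= v t.
    by rewrite /t; case: arg_maxP.
  have : avg v t <= v t.
    by rewrite -[leRHS](mean_cst A_gt0) le_mean // => x; apply/tmax/Fnx.
  by have := vE _ tF; lra.
move=> uE.
have uNE s : s \in F -> - u s = avg (fun t => - u t) s + - c.
  by move=> /uE ->; rewrite /avg meanN opprD.
have c0 : c = 0.
  by apply: le_anti; rewrite (drift_ge0 u) // -oppr_ge0 (drift_ge0 _ _ uNE).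
split=> // s sF; apply: le_anti; apply/andP; split.
  apply: (@maximum_principle F) => // [t tF|t tF _]; first exact: Fconn.
  by rewrite uE // c0 addr0.
rewrite -lerN2; apply: (@maximum_principle F z (fun t => - u t)) => // [t tF|t tF _].
  exact: Fconn.
by rewrite uNE // c0 oppr0 addr0.
Qed.

(** * First and second moments of sums along a random word *)

Variable d : S -> A -> R.

Fixpoint total (s : S) (u : seq A) : R :=
  if u is x :: u' then d s x + total (nx s x) u' else 0.

(** Adding [h] at the current state and subtracting [k] per letter turns the sum into a martingale;
    the induction conditions on the first letter. *)
Lemma mean_total_end n s (h : S -> R) k :
  (forall s, h s + k = avg h s + mean (d s)) ->
  mean (fun u : n.-tuple A => total s u + h (foldl nx s u)) = h s + k * n%:R.
Proof.
move=> hE; elim: n s => [|n IH] s.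
  by rewrite (mean_tuple0 (fun u => total s u + h (foldl nx s u))) /= mulr0; ring.
rewrite (mean_tupleS _ (fun u => total s u + h (foldl nx s u))) /=.
have An : (0 < #|{: n.-tuple A}|)%N by rewrite card_tuple expn_gt0 A_gt0.
under eq_mean => x.
  under eq_mean => u do rewrite -addrA.
  rewrite meanD mean_cst // IH; over.
by rewrite !meanD mean_cst // -/(avg h s) -natr1; have := hE s; lra.
Qed.

Lemma mean_total0 n s : (forall s, mean (d s) = 0) ->
  mean (fun u : n.-tuple A => total s u) = 0.
Proof.
move=> d0; under eq_mean => u do rewrite -[total s u]addr0.
rewrite (@mean_total_end n s (fun=> 0) 0) => [|w]; first by rewrite mul0r addr0.
by rewrite d0 /avg mean_cst.
Qed.

(* For centered increments, squares of totals are additive on average. *)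
Lemma mean_sqr_total_end n s (W : S -> R) v :
  (forall s, mean (d s) = 0) ->
  (forall s, W s + v = avg W s + mean (fun x => d s x ^+ 2)) ->
  mean (fun u : n.-tuple A => total s u ^+ 2 + W (foldl nx s u)) = W s + v * n%:R.
Proof.
move=> d0 WE.
have mean0 m t := mean_total0 m t d0.
elim: n s => [|n IH] s.
  by rewrite (mean_tuple0 (fun u => total s u ^+ 2 + W (foldl nx s u))) /= mulr0; ring.
rewrite (mean_tupleS _ (fun u => total s u ^+ 2 + W (foldl nx s u))) /=.
have An : (0 < #|{: n.-tuple A}|)%N by rewrite card_tuple expn_gt0 A_gt0.
have E x : mean (fun u : n.-tuple A =>
    (d s x + total (nx s x) u) ^+ 2 + W (foldl nx (nx s x) u)) =
    d s x ^+ 2 + (W (nx s x) + v * n%:R).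
  rewrite -(IH (nx s x)) -[d s x ^+ 2](mean_cst An).
  (* The subtracted zero is the cross term of the square: the sum over the remaining letters has
     mean zero. *)
  rewrite -[LHS]subr0 -(mulr0 (d s x *+ 2)) -(mean0 n (nx s x)) -meanZ -meanB -meanD.
  by apply: eq_mean => u; ring.
rewrite (eq_mean E) !meanD mean_cst // -/(avg W s) -natr1.
by have := WE s; lra.
Qed.

End Chain.

(** * Closed walks, directed cycles and potentials *)

Lemma uniq_map_inj_in (I J : eqType) (f : I -> J) (r : seq I) :
  uniq [seq f i | i <- r] -> {in r &, injective f}.
Proof.
elim: r => // a r IH /= /andP[/negP nfa ur] x y; rewrite !inE.
case/predU1P=> [->|xr] /predU1P[->|yr] // fxy; last exact: IH.
  by case: nfa; rewrite fxy map_f.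
by case: nfa; rewrite -fxy map_f.
Qed.

Section Walks.
Variables (R : realType) (T : transducer R).
Implicit Types (s t : state T) (e : edge T) (w : seq (edge T)) (k : R).

(** Both endpoints are explicit, even for the empty walk, so that walks can be cut and
    concatenated. *)
Fixpoint walk s w t : bool :=
  if w is e :: w' then (source e == s) && walk (target e) w' t else s == t.

Lemma walk_cat s w1 w2 t :
  walk s (w1 ++ w2) t <-> exists2 u, walk s w1 u & walk u w2 t.
Proof.
elim: w1 s => [|e w1 IH] s /=.
  by split=> [|[u /eqP ->//]]; exists s.
split=> [/andP[-> /IH]//|[u /andP[-> w1u] w2u]]; apply/IH.
by exists u.
Qed.

Lemma walk_catI s u t w1 w2 : walk s w1 u -> walk u w2 t -> walk s (w1 ++ w2) t.
Proof. by move=> w1u w2t; apply/walk_cat; exists u. Qed.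

Lemma walk_cons_source e s w t : walk s (e :: w) t -> s = source e.
Proof. by case/andP=> /eqP. Qed.

Lemma closed_walk_cons e w : closed_walk (e :: w) = walk (source e) (e :: w) (source e).
Proof.
(* Only the edge preceding [w] is generalised; the edge where the walk closes stays fixed in the
   induction. *)
rewrite /closed_walk /= eqxx /=; move: {1 3}e => f.
by elim: w f => [|g w IH] f /=; rewrite ?andbT // IH [source g == _]eq_sym.
Qed.

Lemma walk_closed s w : walk s w s -> closed_walk w /\ starts_at s w.
Proof.
case: w => [|e w]; first by rewrite /starts_at /= eqxx.
move=> ew; have es := walk_cons_source ew.
by rewrite closed_walk_cons -es ew /starts_at /= es eqxx.
Qed.

Lemma step_edge e : step (source e) (target e).
Proof. by apply/existsP; exists e; rewrite !eqxx. Qed.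

Lemma connect_final s t : s \in final_states T -> connect (@step _ T) s t ->
  t \in final_states T.
Proof.
rewrite !inE => /forallP sP st; apply/forallP => u.
exact: connect_trans (sP u) st.
Qed.

Lemma final_connect s t : t \in final_states T -> connect (@step _ T) s t.
Proof. by rewrite inE => /forallP. Qed.

(** No transition leaves the final component. *)
Lemma final_edgeE e : (e \in final_edges T) = (source e \in final_states T).
Proof.
rewrite inE; case sF: (_ \in _) => //=.
exact: connect_final sF (connect1 (step_edge e)).
Qed.

(** The final component is strongly connected: its states are reachable from everywhere, and a path
    starting in it cannot leave it. *)
Lemma final_walk_exists s t : s \in final_states T -> t \in final_states T ->
  exists2 w, walk s w t & all [in final_edges T] w.
Proof.
move=> sF /(final_connect s) /connectP[p].
elim: p s sF => [|u p IH] s sF /=; first by move=> _ ->; exists [::]; rewrite /= ?eqxx.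
case/andP=> /existsP[e /andP[/eqP es /eqP et]] pth tE.
have eF : e \in final_edges T by rewrite final_edgeE es.
have uF : u \in final_states T by move: eF; rewrite inE et => /andP[].
have [w ww wF] := IH _ uF pth tE.
by exists (e :: w); rewrite /= ?es ?eqxx ?et ?eF.
Qed.

(* [out] is cohomologous to the constant [k] on the final component. *)
Definition potential k (h : state T -> R) : Prop :=
  forall e, e \in final_edges T -> out e = k + h (source e) - h (target e).

Lemma potential_walk k h s w t : potential k h -> walk s w t ->
  all [in final_edges T] w -> \sum_(e <- w) out e = k * (size w)%:R + h s - h t.
Proof.
move=> kh; elim: w s => [|e w IH] s /=.
  by move=> /eqP -> _; rewrite big_nil mulr0 add0r subrr.
case/andP=> /eqP <- wt /andP[eF wF].
rewrite big_cons (IH _ wt wF) (kh _ eF) -natr1; ring.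
Qed.

Lemma potential_closed_walks k h s : potential k h -> closed_walks_through s k.
Proof.
move=> kh [|e w] /andP[cw wF] //.
move: cw; rewrite closed_walk_cons => cw _.
by rewrite (potential_walk kh cw wF) addrK.
Qed.

(* A finite digraph with all out-degrees 1 that is strongly connected has all
   in-degrees 1, so the potential telescopes over its edge set. *)
Lemma potential_directed_cycles k h : potential k h -> all_directed_cycles T k.
Proof.
move=> kh V C [_ /subsetP CF [_ CV conn deg]].
(* With equally many edges and vertices, [source] and [target] are injective on [C] as soon as they
   map onto [V]. *)
have cardV : #|C| = #|V|.
  rewrite -sum1_card (partition_big (@source _ T) [in V]) => [|e /CV /andP[]//].
  rewrite -sum1_card; apply: eq_bigr => s /deg degs.
  by rewrite -[RHS]degs -sum1_card; apply: eq_bigl => e; rewrite inE.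
have edge_at s : s \in V -> exists2 e, e \in C & source e = s.
  move/deg/eqP/cards1P=> [e eE]; exists e; have := finset.set11 e; rewrite -eE inE;
    by case/andP=> // _ /eqP.
have srcV : [set source e | e in C]%SET = V.
  apply/setP => s; apply/imsetP/idP => [[e /CV/andP[sV _] ->]//|/edge_at[e eC <-]].
  by exists e.
have tgtV : [set target e | e in C]%SET = V.
  apply/setP => t; apply/imsetP/idP => [[e /CV/andP[_ tV] ->]//|tV].
  have [e eC et] := edge_at _ tV.
  have /andP[_ e'V] := CV _ eC.
  (* An edge into [t] is the last edge of a path from the target of [e] back to [t], or [e] itself
     if that path is empty. *)
  have /connectP[p] := conn _ _ e'V tV.
  case/lastP: p => [_ ->|p u]; first by exists e.
  rewrite rcons_path last_rcons => /andP[_ /existsP[f /and3P[fC _ /eqP ft]]] ->.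
  by exists f.
have srcI : {in C &, injective (@source _ T)} by apply/imset_injP; rewrite srcV cardV.
have tgtI : {in C &, injective (@target _ T)} by apply/imset_injP; rewrite tgtV cardV.
rewrite (eq_bigr (fun e => k + h (source e) - h (target e))); last by move=> e /CF/kh.
rewrite sumrB big_split /= sumr_const mulr_natr.
by rewrite -(big_imset h srcI) -(big_imset h tgtI) srcV tgtV addrK.
Qed.

(** The potential at [t] is the excess over [k] per edge of a chosen walk [b t] from [t] to [s].
    Comparing the closed walks that reach [source e] and then return either directly or through [e]
    gives the equation at [e]. *)
Lemma potential_exists k s : s \in final_states T ->
  (forall w, walk s w s -> all [in final_edges T] w ->
     \sum_(e <- w) out e = k * (size w)%:R) ->
  exists h, potential k h.
Proof.
move=> sF ws.
have back t : exists w, t \in final_states T -> walk t w s /\ all [in final_edges T] w.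
  (* Outside the final component the empty walk is a dummy value. *)
  case tF: (t \in final_states T); last by exists [::].
  by have [w ww wF] := final_walk_exists tF sF; exists w.
case: (choice back) => b bP.
exists (fun t => \sum_(e <- b t) out e - k * (size (b t))%:R) => e eF.
have /andP[srcF tgtF] : (source e \in final_states T) && (target e \in final_states T).
  by move: eF; rewrite inE.
have [p ps pF] := final_walk_exists sF srcF.
have [b1 b1F] := bP _ srcF; have [b2 b2F] := bP _ tgtF.
have := ws (p ++ b (source e)) (walk_catI ps b1).
have ew : walk (source e) (e :: b (target e)) s by rewrite /= eqxx.
have := ws (p ++ e :: b (target e)) (walk_catI ps ew).
rewrite !all_cat pF b1F /= eF b2F !big_cat big_cons /= !size_cat /= !natrD -natr1.
move=> /(_ isT) h1 /(_ isT) h2; lra.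
Qed.

(** Induction on the length: cutting at a later visit to [s] gives two shorter closed walks at [s];
    without such a visit the hypothesis applies directly. *)
Lemma closed_walks_through_start s k : closed_walks_through s k ->
  forall w, walk s w s -> all [in final_edges T] w ->
    \sum_(e <- w) out e = k * (size w)%:R.
Proof.
move=> sk w; have [n] := ubnP (size w).
elim: n w => // n IH [|e w] /=; first by rewrite big_nil mulr0.
rewrite ltnS => wn ew /andP[eF wF].
have es : s = source e by case/andP: ew => /eqP.
have [/hasP[f fw /eqP fs]|/hasPn nos] := boolP (has (fun f => source f == s) w).
  case/path.splitPr: fw wn wF ew => w1 w2.
  rewrite size_cat all_cat => wn /andP[w1F w2F].
  rewrite -[_ && _]/(walk s ((e :: w1) ++ f :: w2) s) => /walk_cat[u ew1 fw2].
  have us : u = s by rewrite (walk_cons_source fw2).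
  move: us ew1 fw2 => -> ew1 fw2.
  rewrite -cat_cons big_cat -addSn natrD mulrDr; congr (_ + _).
    by apply: IH => //=; [move: wn => /=; lia | rewrite eF].
  by apply: IH => //; move: wn => /=; lia.
apply: sk.
  rewrite /final_closed_walk closed_walk_cons -es /= eF wF !andbT.
  exact: ew.
rewrite /visits_exactly_once /= -es eqxx.
rewrite (eq_in_count (a2 := pred0)) ?count_pred0 // => f /nos /negbTE //.
Qed.

Lemma walk_connect (r : rel (state T)) s w t : walk s w t ->
  (forall e, e \in w -> r (source e) (target e)) -> connect r s t.
Proof.
elim: w s => [|e w IH] s /=; first by move=> /eqP ->; rewrite connect0.
case/andP=> /eqP <- ewt ewr.
apply: connect_trans (connect1 (ewr e _)) (IH _ ewt _); first exact: mem_head.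
by move=> f fw; apply: ewr; rewrite inE fw orbT.
Qed.

Lemma simple_closed_walk_cycle w : w != [::] -> final_closed_walk w ->
  uniq [seq source e | e <- w] ->
  final_directed_cycle [set s in [seq source e | e <- w]]%SET [set e in w]%SET.
Proof.
case: w => // e0 w0 _; set w := e0 :: w0; case/andP=> cw wF uw.
have wF' e : e \in w -> e \in final_edges T by move/allP: wF; apply.
move: cw; rewrite closed_walk_cons -/w => cw.
have e0w : e0 \in w by rewrite mem_head.
clearbody w.
have wsrc e : e \in w -> source e \in [seq source e | e <- w].
  by move=> ew; apply: map_f.
have split_at e : e \in w -> exists w1 w2, [/\ w = w1 ++ e :: w2,
    walk (source e0) w1 (source e) & walk (source e) (e :: w2) (source e0)].
  move=> ew; move: cw; case/path.splitPr: ew => w1 w2 /walk_cat[u w1u w2u].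
  by exists w1, w2; rewrite -(walk_cons_source w2u).
split.
- apply/subsetP => s; rewrite inE => /mapP[e /wF']; rewrite inE.
  by case/andP=> + _ ->.
- by apply/subsetP => e; rewrite inE => /wF'.
split.
- by apply/set0Pn; exists (source e0); rewrite in_set wsrc.
- move=> e; rewrite !in_set => ew; rewrite wsrc //=.
  (* The target of [e] is the base point if [e] is the last edge, and the source of the next edge
     [f] otherwise. *)
  have [w1 [[|f w2] [wE _ /andP[_ ew2]]]] := split_at _ ew.
    by move: ew2 => /= /eqP ->; rewrite wsrc.
  by rewrite (walk_cons_source ew2) wsrc // wE mem_cat !inE eqxx !orbT.
- move=> s t; rewrite !inE => /mapP[e ew ->] /mapP[f fw ->].
  (* From the first state, follow the walk to its base point; from there, follow it again to the
     second state. *)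
  have [w1 [w2 [wE _ ew2]]] := split_at _ ew.
  have [w3 [w4 [wE' fw3 _]]] := split_at _ fw.
  apply: (walk_connect (walk_catI ew2 fw3)) => g gw.
  apply/existsP; exists g; rewrite !eqxx !andbT inE.
  move: gw; rewrite mem_cat => /orP[gw|gw]; [rewrite wE|rewrite wE'];
    by rewrite mem_cat gw ?orbT.
move=> s; rewrite inE => /mapP[e ew ->]; apply/eqP/cards1P; exists e.
apply/setP => f; rewrite !inE; apply/andP/eqP => [[fw /eqP fe]|->]; last by rewrite ew.
exact: (uniq_map_inj_in uw).
Qed.

(** Induction on the length: a repeated source excises a shorter closed walk and leaves another one;
    a nonempty closed walk with distinct sources traverses a directed cycle. *)
Lemma directed_cycles_closed_walks k : all_directed_cycles T k ->
  forall w, final_closed_walk w -> \sum_(e <- w) out e = k * (size w)%:R.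
Proof.
move=> ck w; have [n] := ubnP (size w).
elim: n w => // n IH w wn wC.
have [->|w0] := eqVneq w [::]; first by rewrite big_nil mulr0.
have [uw|nuw] := boolP (uniq [seq source e | e <- w]).
  have uw' := map_uniq uw.
  have := ck _ _ (simple_closed_walk_cycle w0 wC uw).
  rewrite cardsE (card_uniqP uw') => <-.
  by rewrite big_uniq //; apply: eq_bigl => e; rewrite inE.
have [w1 [e [w2 [f [w3 [wE ef]]]]]] : exists w1 e w2 f w3,
    w = w1 ++ e :: w2 ++ f :: w3 /\ source e = source f.
  elim: w nuw {IH wn wC w0} => // e w IH /=; rewrite negb_and negbK.
  case/orP=> [/mapP[f fw ef]|/IH[w1 [e' [w2 [f [w3 [-> ef]]]]]]].
    by case/path.splitPr: fw => w2 w3; exists [::], e, w2, f, w3.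
  by exists (e :: w1), e', w2, f, w3.
have [z zw] : exists z, walk z w z.
  case: w w0 wC {wn wE nuw} => // g w _ /andP[gw _].
  by exists (source g); rewrite -closed_walk_cons.
have wF : all [in final_edges T] w by case/andP: wC.
move: wF wn zw; rewrite {w wC nuw w0}wE => wF wn /walk_cat[u w1u].
rewrite -cat_cons => /walk_cat[v ew2 fw3].
have uE := walk_cons_source ew2; have vE := walk_cons_source fw3.
rewrite -ef in vE; subst u v.
move: wF; rewrite all_cat -cat_cons all_cat => /and3P[w1F w2F w3F].
have := IH (w1 ++ f :: w3); have := IH (e :: w2).
rewrite /final_closed_walk all_cat w1F w2F w3F.
have [-> _] := walk_closed ew2; have [-> _] := walk_closed (walk_catI w1u fw3).
rewrite !size_cat !big_cat /= => h1 h2.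
rewrite addrCA h1 // ?h2 //.
- rewrite -mulrDr -natrD; congr (_ * _%:R); rewrite /= ; lia.
- move: wn; rewrite size_cat /= size_cat /=; lia.
- move: wn; rewrite size_cat /= size_cat /=; lia.
Qed.

End Walks.

(** * Moments of the output *)

Local Open Scope classical_set_scope.

Lemma bounded_bigO1 (R : realType) (f : nat -> R^o) (C : R) :
  (forall n, `|f n| <= C) -> f =O_\oo (fun=> 1 : R^o).
Proof.
move=> fC; apply/eqO_exP; exists (`|C| + 1); first by rewrite ltr_wpDl.
apply: nearW => n; rewrite normr1 mulr1.
by apply: le_trans (fC n) _; apply: le_trans (ler_norm C) _; rewrite lerDl.
Qed.

Lemma bigO1_bounded (R : realType) (f : nat -> R^o) :
  f =O_\oo (fun=> 1 : R^o) -> exists C : R, exists N, forall n, (N <= n)%N -> `|f n| <= C.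
Proof.
move=> /eqO_exP[C _ [N _ Nf]]; exists C, N => n Nn.
by have := Nf n Nn; rewrite normr1 mulr1.
Qed.

Local Close Scope classical_set_scope.

Lemma linear_bounded_above (R : realType) (v C : R) (N : nat) :
  (forall n, (N <= n)%N -> v * n%:R <= C) -> v <= 0.
Proof.
move=> vC; rewrite leNgt; apply/negP => v0.
pose m := Num.Def.archi_bound (`|C| / v).
have := vC (m + N)%N (leq_addl _ _); apply/negP; rewrite -ltNge.
apply: le_lt_trans (ler_norm C) _.
rewrite mulrC -ltr_pdivrMr //.
apply: lt_le_trans (archi_boundP _) _; first by rewrite divr_ge0 // ltW.
by rewrite ler_nat leq_addr.
Qed.

Lemma fin_bounded (R : realType) (I : finType) (f : I -> R) :
  exists C : R, forall i, `|f i| <= C.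
Proof.
exists (\sum_i `|f i|) => i.
by rewrite (bigD1 i) //= lerDl sumr_ge0.
Qed.

Section Output.
Variables (R : realType) (T : subsequential R).
Hypothesis A_gt0 : (0 < #|{: letter T}|)%N.
Hypothesis hcomplete : complete T.
Implicit Types (s t : state T) (x : letter T).

Definition next s x : state T := xchoose (hcomplete s x).

Definition next_edge s x : edge T :=
  exist _ (s, next s x, x) (xchooseP (hcomplete s x)).

(** By determinism, edges correspond to pairs of a state and a letter, so uniform letters drive a
    Markov chain on the states. *)
Lemma next_edge_unique (e : edge T) : e = next_edge (source e) (label e).
Proof.
apply: val_inj; case: e => -[[s t] x] /= sx.
rewrite -[RHS]/(s, next s x, x).
by rewrite (subseq_deterministic sx (xchooseP (hcomplete s x))).
Qed.

Lemma run_cons s x u : run s (x :: u) = next_edge s x :: run (next s x) u.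
Proof.
rewrite /=; case: pickP => [e /andP[/eqP es /eqP ex]|/(_ (next_edge s x))].
  by rewrite [e]next_edge_unique es ex.
by rewrite !eqxx.
Qed.

Let cost s x := out (next_edge s x).

Lemma sum_run s u : \sum_(e <- run s u) out e = total next cost s u.
Proof.
elim: u s => [|x u IH] s; first by rewrite big_nil.
by rewrite run_cons big_cons IH.
Qed.

Lemma last_run s u : last s [seq target e | e <- run s u] = foldl next s u.
Proof. by elim: u s => // x u IH s; rewrite run_cons /= IH. Qed.

Lemma outputE u :
  output u = total next cost (initial T) (rev u)
    + val (final_output (foldl next (initial T) (rev u))).
Proof.
by rewrite /output /output_sequence -cats1 big_cat big_seq1 big_map sum_run last_run.
Qed.

Lemma reachE s t : reach next s t = connect (@step _ T) s t.
Proof.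
apply: eq_connect => u w; apply/existsP/existsP => [[x /eqP xw]|[e /andP[/eqP eu /eqP ew]]].
  by exists (next_edge u x); rewrite !eqxx /= /target /= xw eqxx.
by exists (label e); rewrite -ew [in target e](next_edge_unique e) eu.
Qed.

Lemma next_final s x : s \in final_states T -> next s x \in final_states T.
Proof.
by move=> sF; apply: connect_final sF (connect1 (step_edge (next_edge s x))).
Qed.

Hypothesis hconnected : finally_connected T.

Definition poisson k (h : state T -> R) : Prop :=
  forall s, h s + k = avg next h s + mean (cost s).

Definition residual k (h : state T -> R) s x := cost s x - k + h (next s x) - h s.

Lemma mean_residual k h : poisson k h -> forall s, mean (residual k h s) = 0.
Proof.
move=> kh s; rewrite /residual !meanB meanD !mean_cst // -/(avg next h s).
have := kh s; rewrite meanB mean_cst //; lra.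
Qed.

Lemma total_residual k h s u :
  total next (residual k h) s u =
  total next cost s u - k * (size u)%:R + h (foldl next s u) - h s.
Proof.
elim: u s => [|x u IH] s /=; first by ring.
by rewrite IH /residual -natr1; ring.
Qed.

(** The differences of [h] telescope, so the correction [b] depends on the last state alone and is
    bounded uniformly in [n]. *)
Lemma output_residual k h : exists b : state T -> R, forall n (u : n.-tuple (letter T)),
  output u = total next (residual k h) (initial T) (rev u) + k * n%:R
    + b (foldl next (initial T) (rev u)).
Proof.
exists (fun s => val (final_output s) - h s + h (initial T)) => n u.
by rewrite outputE total_residual size_rev size_tuple; ring.
Qed.

Lemma residual_potential k h :
  (forall s x, s \in final_states T -> residual k h s x = 0) <-> potential k h.
Proof.
split=> [res0 e|kh s x sF].
  rewrite final_edgeE [e]next_edge_unique => /(res0 _ (label e)).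
  rewrite /residual /cost /source /target /=; lra.
have := kh (next_edge s x); rewrite final_edgeE => /(_ sF).
by rewrite /residual /cost => ->; rewrite /source /target /=; ring.
Qed.

Lemma poisson_mean k h : poisson k h -> is_asymptotic_mean T k.
Proof.
move=> kh; have [b bE] := output_residual k h.
have [C bC] := fin_bounded b.
apply: (@bounded_bigO1 _ _ C) => n.
have An : (0 < #|{: n.-tuple (letter T)}|)%N by rewrite card_tuple expn_gt0 A_gt0.
rewrite -[expect _]/(mean _) (eq_mean (bE n)) !meanD mean_cst //.
rewrite (mean_rev n (fun u => total next (residual k h) (initial T) u)).
rewrite (mean_total0 next A_gt0 n (initial T) (mean_residual kh)).
rewrite add0r addrAC subrr add0r ler_norml.
rewrite -[C in X in _ && X](mean_cst An) -[- C](mean_cst An).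
by apply/andP; split; apply: le_mean => u; have := bC (foldl next (initial T) (rev u));
  rewrite ler_norml => /andP[].
Qed.

(* Up to bounded terms the output is [k n] plus a martingale, so its variance
   and the second moment of the martingale bound each other. *)
Lemma variance_martingale k h : poisson k h -> exists C : R, forall n,
  let V := variance (fun u : n.-tuple (letter T) => output u) in
  let Q := mean (fun u : n.-tuple (letter T) =>
                   total next (residual k h) (initial T) u ^+ 2) in
  V <= 2 * Q + C /\ Q <= 2 * V + C.
Proof.
move=> kh; have [b bE] := output_residual k h.
have [C bC] := fin_bounded b.
(* The centered correction is at most [2 * C] in absolute value; the factor 2 comes from bounding
   the square of a sum by twice the sum of the squares. *)
exists (2 * (2 * C) ^+ 2) => n V Q.
have An : (0 < #|{: n.-tuple (letter T)}|)%N by rewrite card_tuple expn_gt0 A_gt0.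
pose M (u : n.-tuple (letter T)) := total next (residual k h) (initial T) (rev u).
pose B (u : n.-tuple (letter T)) := b (foldl next (initial T) (rev u)).
have QE : Q = mean (fun u => M u ^+ 2).
  by rewrite /M (mean_rev n (fun u => total next (residual k h) (initial T) u ^+ 2)).
have M0 : mean M = 0.
  rewrite /M (mean_rev n (fun u => total next (residual k h) (initial T) u)).
  exact: (mean_total0 next A_gt0 n (initial T) (mean_residual kh)).
have VE : V = mean (fun u => (M u + (B u - mean B)) ^+ 2).
  rewrite /V /variance -[expect _]/(mean _); apply: eq_mean => u.
  rewrite -[expect _]/(mean _) (eq_mean (bE n)) !meanD mean_cst // -/M M0.
  by rewrite bE -/(M u) -/(B u) -/B; congr (_ ^+ 2); ring.
have BC u : (B u - mean B) ^+ 2 <= (2 * C) ^+ 2.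
  have lo w : - C <= B w by have := bC (foldl next (initial T) (rev w));
    rewrite ler_norml => /andP[].
  have hi w : B w <= C by have := bC (foldl next (initial T) (rev w));
    rewrite ler_norml => /andP[].
  have mlo : - C <= mean B by rewrite -[- C](mean_cst An) le_mean.
  have mhi : mean B <= C by rewrite -[leRHS](mean_cst An) le_mean.
  have := lo u; have := hi u => h1 h2.
  have : 0 <= (2 * C - (B u - mean B)) * (2 * C + (B u - mean B)).
    by rewrite mulr_ge0; lra.
  by rewrite !expr2; lra.
have sqrD (x y c : R) : y ^+ 2 <= c -> (x + y) ^+ 2 <= 2 * x ^+ 2 + 2 * c.
  by move=> yc; have := sqr_ge0 (x - y); rewrite !expr2 in yc *; nra.
split.
  rewrite VE QE -meanZ -[2 * _ ^+ 2 in leRHS](mean_cst An) -meanD.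
  by apply: le_mean => u; apply: sqrD.
rewrite VE QE -meanZ -[2 * _ ^+ 2 in leRHS](mean_cst An) -meanD.
apply: le_mean => u.
rewrite -[X in X ^+ 2](addrK (B u - mean B)); apply: sqrD.
by rewrite sqrrN.
Qed.

Lemma asymptotic_variance0 k h : poisson k h ->
  is_asymptotic_variance T 0 <->
  forall s x, s \in final_states T -> residual k h s x = 0.
Proof.
move=> kh; have [C VQ] := variance_martingale kh.
case: hconnected => z zT.
have zF : z \in final_states T by rewrite inE.
have reachF s t : t \in final_states T -> reach next s t.
  by rewrite reachE; apply: final_connect.
pose sigma s := mean (fun x => residual k h s x ^+ 2).
have sigma_ge0 s : 0 <= sigma s by apply: mean_ge0 => x; apply: sqr_ge0.
(* A second Poisson equation, with the conditional variance [sigma] as reward: its constant [v] is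
   the growth rate of [Q]. *)
have [v [W WE]] := poisson_solvable A_gt0 (fun s => reachF s z zF) sigma.
have [K WK] := fin_bounded W.
have K_ge0 : 0 <= K by apply: le_trans (WK z).
pose Q n := mean (fun u : n.-tuple (letter T) =>
                    total next (residual k h) (initial T) u ^+ 2).
have QE n : exists2 c, `|c| <= 2 * K & Q n = v * n%:R + c.
  exists (W (initial T) - mean (fun u : n.-tuple (letter T) => W (foldl next (initial T) u))).
    have An : (0 < #|{: n.-tuple (letter T)}|)%N by rewrite card_tuple expn_gt0 A_gt0.
    have Wb s : - K <= W s <= K by rewrite -ler_norml.
    have := Wb (initial T).
    have : mean (fun u : n.-tuple (letter T) => W (foldl next (initial T) u)) <= K.
      by rewrite -[leRHS](mean_cst An) le_mean // => u; case/andP: (Wb (foldl next (initial T) u)).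
    have : - K <= mean (fun u : n.-tuple (letter T) => W (foldl next (initial T) u)).
      by rewrite -[leLHS](mean_cst An) le_mean // => u; case/andP: (Wb (foldl next (initial T) u)).
    by move=> h1 h2 /andP[h3 h4]; rewrite ler_norml; lra.
  have := mean_sqr_total_end A_gt0 n (initial T) (mean_residual kh) WE.
  by rewrite meanD -/(Q n); lra.
split=> [/bigO1_bounded[B [N VB]] s x sF|res0].
  have v_le0 : v <= 0.
    apply: (@linear_bounded_above _ _ (2 * B + C + 2 * K) N) => n Nn.
    have [_ QV] := VQ n; have [c cK Qc] := QE n.
    have := VB n Nn; rewrite mul0r subr0 => Vn.
    have := ler_norm (variance (fun u : n.-tuple (letter T) => output u)).
    have : - c <= `|c| by rewrite -normrN ler_norm.
    move: QV; rewrite -/(Q n) Qc /=; lra.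
  (* As [sigma >= 0] and [v <= 0], the function [- W] is subharmonic everywhere. It is thus maximal
     at the final state [s], and the equation at [s] gives [sigma s <= v <= 0]. *)
  have super t : - W t <= avg next (fun t => - W t) t.
    by have := sigma_ge0 t; have := WE t; rewrite /avg meanN -/(avg next W t); lra.
  have Wmin t : W s <= W t.
    rewrite -lerN2; apply: (@maximum_principle _ _ _ next A_gt0 predT s (fun t => - W t)) => //.
    by move=> w _; apply: reachF.
  have Ws : W s <= avg next W s by rewrite -[leLHS](mean_cst A_gt0) le_mean.
  apply: (mean_sqr_eq0 A_gt0); rewrite -/(sigma s).
  by have := WE s; lra.
(* With [sigma] zero on the final component, [W] solves the source-free equation there with drift
   [- v]. *)
have [v0 _] : - v = 0 /\ forall s, s \in final_states T -> W s = W z.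
  apply: (@poisson_unique _ _ _ next A_gt0 [in final_states T]) => //.
  - by move=> s x; apply: next_final.
  - by move=> s t _; apply: reachF.
  move=> s sF; have : sigma s = 0.
    by rewrite /sigma (eq_mean (g := fun=> 0)) ?mean_cst // => x; rewrite res0 // expr0n.
  by have := WE s; lra.
apply: (@bounded_bigO1 _ _ (2 * (2 * K) + C)) => n.
have [VQn _] := VQ n; have [c cK Qc] := QE n.
have V_ge0 : 0 <= variance (fun u : n.-tuple (letter T) => output u).
  by apply: mean_ge0 => u; apply: sqr_ge0.
rewrite mul0r subr0 ger0_norm //; apply: le_trans VQn _.
rewrite -/(Q n) Qc; have : v * n%:R = 0 by rewrite -[v]opprK v0 oppr0 mul0r.
have := ler_norm c; lra.
Qed.

(** On the final component [h - h'] solves the source-free equation with drift [k' - k]. By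
    uniqueness the drift is zero and [h - h'] is constant, so both pairs have the same residuals
    there. *)
Lemma potential_poisson k h k' h' : poisson k h -> potential (T := T) k' h' ->
  k' = k /\ forall s x, s \in final_states T -> residual k h s x = 0.
Proof.
move=> kh; rewrite -residual_potential => res0.
case: hconnected => z zT.
have zF : z \in final_states T by rewrite inE.
have [kk u_cst] : k' - k = 0 /\
    forall s, s \in final_states T -> h s - h' s = h z - h' z.
  apply: (@poisson_unique _ _ _ next A_gt0 [in final_states T] (fun s => h s - h' s)) => //.
  - by move=> s x; apply: next_final.
  - by move=> s t _ tF; rewrite reachE final_connect.
  move=> s sF; have : mean (residual k' h' s) = 0.
    by rewrite (eq_mean (g := fun=> 0)) ?mean_cst // => x; rewrite res0.
  rewrite /residual !meanB meanD !mean_cst // -/(avg next h' s).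
  by have := kh s; rewrite meanB mean_cst // /avg meanB -/(avg next h s) -/(avg next h' s); lra.
split=> [|s x sF]; first by lra.
have := u_cst _ sF; have := u_cst _ (next_final x sF).
have := res0 s x sF; rewrite /residual; lra.
Qed.

End Output.

(** * The equivalences and the expected value, all through the existence of a potential *)

Theorem theorem3p1 (R : realType) (T : subsequential R)
    (hA : (1 < #|{: letter T}|)%N)
    (hcomplete : complete T)
    (hconnected : finally_connected T)
    (haperiodic : finally_aperiodic T) :
  [<-> is_asymptotic_variance T 0%R;
       exists s, s \in final_states T /\
         exists k : R, closed_walks_through s k;
       exists k : R, all_directed_cycles T k] /\
  (forall k : R,
     (exists s, s \in final_states T /\ closed_walks_through s k) \/
       all_directed_cycles T k ->
     is_asymptotic_mean T k /\
     forall s, s \in final_states T -> closed_walks_through s k).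
Proof.
have A_gt0 : (0 < #|{: letter T}|)%N by apply: ltn_trans hA.
have [z zT] := hconnected.
have zF : z \in final_states T by rewrite inE.
have [k [h kh]] : exists k h, poisson hcomplete k h.
  apply: (poisson_solvable A_gt0 (z := z)) => s.
  by rewrite reachE final_connect.
have walks_potential s k' : s \in final_states T -> closed_walks_through s k' ->
    exists h', potential (T := T) k' h'.
  move=> sF sk; apply: (potential_exists sF).
  exact: closed_walks_through_start.
have cycles_potential k' : all_directed_cycles T k' -> exists h', potential (T := T) k' h'.
  move=> ck; apply: (potential_exists zF) => w zw wF.
  apply: directed_cycles_closed_walks => //.
  by rewrite /final_closed_walk (walk_closed zw).1.
split.
  tfae.
  - move=> /(asymptotic_variance0 A_gt0 hconnected kh)/residual_potential pot.
    by exists z; split=> //; exists k; apply: potential_closed_walks pot.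
  - move=> [s [sF [k' /(walks_potential _ _ sF)[h' pot]]]].
    by exists k'; apply: potential_directed_cycles pot.
  - move=> [k' /cycles_potential[h' pot]].
    apply/(asymptotic_variance0 A_gt0 hconnected kh).
    by have [] := potential_poisson A_gt0 hconnected kh pot.
move=> k' walks_or_cycles.
have [h' pot] : exists h', potential (T := T) k' h'.
  by case: walks_or_cycles => [[s [sF /(walks_potential _ _ sF)]]|/cycles_potential].
split=> [|s _]; last exact: potential_closed_walks pot.
(* The constant of any potential is the Poisson constant [k], which is the mean output per
   letter. *)
have [-> _] := potential_poisson A_gt0 hconnected kh pot.
exact: poisson_mean kh.
Qed.
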